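(* Assume Conditions C1, C2 and C3 hold, with $p$ arbitrary, and let the threshold satisfy $\gamma^{-1}=o(n^{-1})$. Then for any pair $jk$ with $j<k$ and $\theta_{jk}=0$, $\Pr(jk\in\hat{\mathcal E}\mid jk\in\setminus\mathcal E)\to 0$ as $n\to\infty$.
   Context: Setting: $X=(X_1,\dots,X_p)^\top$ is a random vector with mean zero and positive definite covariance $\Theta=(\theta_{jk})$; $X^{(1)},\dots,X^{(n)}$ are i.i.d. copies; $S=(S_{jk})=n^{-1}\sum_i X^{(i)}X^{(i)\top}$. Index the $m=p(p+1)/2$ pairs $jk$, $1\le j\le k\le p$, in the order $11,12,\dots,1p,22,\dots,pp$; $\theta=\mathrm{vech}(\Theta)$, $s=\mathrm{vech}(S)\in\mathbb{R}^m$. For $\vartheta\in\mathbb{R}^m$ (a symmetric matrix) and $x\in\mathbb{R}^p$: $\ell_{jj}(\vartheta;x)=-\log\vartheta_{jj}-x_j^2/\vartheta_{jj}$; for $j<k$, $\ell_{jk}(\vartheta;x)=-\log(\vartheta_{jj}\vartheta_{kk}-\vartheta_{jk}^2)-(\vartheta_{kk}x_j^2-2\vartheta_{jk}x_jx_k+\vartheta_{jj}x_k^2)/(\vartheta_{jj}\vartheta_{kk}-\vartheta_{jk}^2)$; $u_{jk}(\vartheta;x)=\partial\ell_{jk}/\partial\vartheta\in\mathbb{R}^m$. $U(\vartheta;x)$ is the $m\times m$ matrix with columns $u_{jk}(\vartheta;x)$. Let $J=\mathbb{E}[U(\theta;X)^\top U(\theta;X)]$, $h=\mathrm{diag}(J)$,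 $\hat J=n^{-1}\sum_i U(s;X^{(i)})^\top U(s;X^{(i)})$, $\hat h=\mathrm{diag}(\hat J)$. For index sets $A,B$: $a_A$ is a subvector, $M_A$ the principal submatrix, $M_{A,B}$ the submatrix with rows $A$, columns $B$. Procedure: for $\lambda\ge0$ let $\hat w(\lambda)$ minimize $\frac12 w^\top\hat Jw-w^\top\hat h+\frac{\lambda}{n}\sum_{j<k}|w_{jk}|/S_{jk}^2$ and $\hat{\mathcal E}(\lambda)=\{jk:\hat w_{jk}(\lambda)\ne0\}$. Given $\gamma>0$, $\hat\lambda=\inf\{\lambda: nS_{jk}^2/(S_{jk}^2+S_{jj}S_{kk})>\gamma\text{ for all } jk\in\hat{\mathcal E}(\lambda)\}$ and $\hat{\mathcal E}=\hat{\mathcal E}(\hat\lambda)$. Let $\mathcal E=\{jk:j\le k,\theta_{jk}\ne0\}$, $\setminus\mathcal E=\{jk:j<k,\theta_{jk}=0\}$, $m_0$ the number of off-diagonal pairs in $\mathcal E$, and $\xi=\{jk:j<k,\theta_{jk}\ne0\}\cup\{jj:\theta_{jl}\ne0\text{ for some }l\ne j\}$. Conditions: C1: the entries of $\Theta$ are uniformly bounded, and its nonzero entries are bounded away from $0$ in absolute value. C2: the entries of $J$, $J_\xi^{-1}$ and $J_\xi^{-1}h_\xi$ are uniformly bounded. C3: there is a constant $c>0$, for all $m_0\ge1$, such that $\min_x\|J_{\xi,\xi_{-l}}x-h_\xi\|_1>c$ for every $l=1,\dots,|\xi|$, where $x\in\mathbb{R}^{|\xi|-1}$ and $J_{\xi,\xi_{-l}}$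 is $J_\xi$ with its $l$-th column removed.
   Formalization: In the definition of λ̂ the threshold condition is imposed only on off-diagonal pairs jk; for diagonal pairs the statistic is n/2, eventually below γ, so the literal set of λ would be empty and λ̂ undefined. *)

(* Defs.v *)
From HB Require Import structures.
From mathcomp Require Import all_boot all_order all_algebra.
From mathcomp Require Import all_classical all_reals all_analysis.
Set Implicit Arguments. Unset Strict Implicit. Unset Printing Implicit Defensive.
Import Order.TTheory GRing.Theory Num.Theory.
Import numFieldNormedType.Exports.
Local Open Scope classical_set_scope.
Local Open Scope ring_scope.

Section Defs.
Variable R : realType.

(* Index set of pairs jk, j <= k (ordering is immaterial: vectors in R^m are
   represented as functions on this finite type). *)
Definition pairT (p : nat) := {x : 'I_p * 'I_p | (x.1 <= x.2)%N}.

Definition spair (p : nat) (j k : 'I_p) : pairT p :=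
  insubd (exist _ (j, j) (leqnn j) : pairT p)
         (if (j <= k)%N then (j, k) else (k, j)).

Definition pj p (a : pairT p) : 'I_p := (val a).1.
Definition pk p (a : pairT p) : 'I_p := (val a).2.
Definition offdiag p (a : pairT p) : bool := (pj a < pk a)%N.

(* entry jk of the symmetric matrix represented by vartheta *)
Definition ent p (v : pairT p -> R) (j k : 'I_p) : R := v (spair j k).

Definition vech p (M : 'M[R]_p) : pairT p -> R := fun a => M (pj a) (pk a).

Definition ell p (a : pairT p) (v : pairT p -> R) (x : 'I_p -> R) : R :=
  let j := pj a in let k := pk a in
  if j == k then - ln (ent v j j) - x j ^+ 2 / ent v j j
  else
    let D := ent v j j * ent v k k - ent v j k ^+ 2 in
    - ln D - (ent v k k * x j ^+ 2 - 2 * ent v j k * x j * x k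
              + ent v j j * x k ^+ 2) / D.

Definition uvec p (a : pairT p) (v : pairT p -> R) (x : 'I_p -> R)
  : pairT p -> R :=
  fun b => derive1 (fun t : R => ell a (fun c => v c + (if c == b then t else 0)) x) 0.

Definition UtU p (v : pairT p -> R) (x : 'I_p -> R) (a b : pairT p) : R :=
  \sum_(c : pairT p) uvec a v x c * uvec b v x c.

Definition Jmat {d} {T : measurableType d} (P : probability T R) p
  (Theta : 'M[R]_p) (X : 'I_p -> T -> R) (a b : pairT p) : R :=
  fine ('E_P[fun w => UtU (vech Theta) (fun j => X j w) a b]).

Definition Scov {T} p n (Xs : 'I_n -> 'I_p -> T -> R) (w : T) : 'M[R]_p :=
  \matrix_(j, k) ((n%:R)^-1 * \sum_(i < n) Xs i j w * Xs i k w).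

Definition Jhat {T} p n (Xs : 'I_n -> 'I_p -> T -> R) (w : T) (a b : pairT p) : R :=
  (n%:R)^-1 * \sum_(i < n) UtU (vech (Scov Xs w)) (fun j => Xs i j w) a b.

Definition objective {T} p n (Xs : 'I_n -> 'I_p -> T -> R) (om : T)
  (lam : R) (w : pairT p -> R) : R :=
  2^-1 * (\sum_(a : pairT p) \sum_(b : pairT p) w a * Jhat Xs om a b * w b)
  - \sum_(a : pairT p) w a * Jhat Xs om a a
  + lam / n%:R * \sum_(a : pairT p | offdiag a)
      `|w a| / (Scov Xs om (pj a) (pk a)) ^+ 2.

(* feasibility: the penalty |w_jk|/S_jk^2 is +oo when S_jk = 0 and w_jk <> 0 *)
Definition feasible {T} p n (Xs : 'I_n -> 'I_p -> T -> R) (om : T)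
  (w : pairT p -> R) : Prop :=
  forall a : pairT p, offdiag a -> Scov Xs om (pj a) (pk a) = 0 -> w a = 0.

Definition is_minimizer {T} p n (Xs : 'I_n -> 'I_p -> T -> R) (om : T)
  (lam : R) (w : pairT p -> R) : Prop :=
  feasible Xs om w /\
  forall w', feasible Xs om w' -> objective Xs om lam w <= objective Xs om lam w'.

Definition tstat {T} p n (Xs : 'I_n -> 'I_p -> T -> R) (om : T) (a : pairT p) : R :=
  let S := Scov Xs om in
  n%:R * S (pj a) (pk a) ^+ 2 /
    (S (pj a) (pk a) ^+ 2 + S (pj a) (pj a) * S (pk a) (pk a)).

Definition lamhat {T} p n (Xs : 'I_n -> 'I_p -> T -> R)
  (what : T -> R -> pairT p -> R) (gam : R) (om : T) : R :=
  inf [set lam : R | 0 <= lam /\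
        forall a : pairT p, offdiag a -> what om lam a != 0 -> gam < tstat Xs om a].

Definition Ehat {T} p n (Xs : 'I_n -> 'I_p -> T -> R)
  (what : T -> R -> pairT p -> R) (gam : R) (om : T) : set (pairT p) :=
  [set a | what om (lamhat Xs what gam om) a != 0].

Definition offsupp p (Theta : 'M[R]_p) : {set pairT p} :=
  [set a | offdiag a && (Theta (pj a) (pk a) != 0)].

Definition xi p (Theta : 'M[R]_p) : {set pairT p} :=
  offsupp Theta :|:
  [set a | (pj a == pk a) && [exists l : 'I_p, (l != pj a) && (Theta (pj a) l != 0)]].

Definition subM p (A : pairT p -> pairT p -> R) (E : {set pairT p}) : 'M[R]_#|E| :=
  \matrix_(i, j) A (enum_val i) (enum_val j).
Definition subV p (h : pairT p -> R) (E : {set pairT p}) : 'cV[R]_#|E| :=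
  \col_i h (enum_val i).

Definition posdef p (M : 'M[R]_p) : Prop :=
  M^T = M /\ forall v : 'cV[R]_p, v != 0 -> 0 < (v^T *m M *m v) ord0 ord0.

End Defs.

(* Main.v *)
(* The threshold is eventually at least n, while n S_jk^2 / (S_jk^2 + S_jj S_kk)
   never exceeds n; so the estimator takes the smallest penalty level at which
   the chosen minimizer is diagonal.  The objective is a convex quadratic with a
   Gram matrix, bounded below at level 0, so two minimizers at the same level have
   the same fit and the same penalty.  Hence an off-diagonal entry jk can be
   selected only at level 0, and only if the diagonal vector of ones, w0, already
   minimizes the unpenalized objective.

   In that case the component jk of the fit equation says that the score of the
   pair jk has zero component jk at every observation: with z = S^-1 (x_j, x_k),
   the product z_1 z_2 is constant on the sample.  Stationarity of w0 says that
   J_{jk,jj} + J_{jk,kk} = J_{jk,jk} for the empirical J.  On the conic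
   z_1 z_2 = const the difference of the two sides is
   S_jk^2 (S_jj^-2 + S_kk^-2) times the empirical covariance of z_1^2 and z_2^2,
   that is, times -1 / (S_jj S_kk - S_jk^2), which is not zero.  So jk is never
   selected when the 2 x 2 block of S at j, k is positive definite, and by
   Chebyshev's inequality this holds with probability tending to 1. *)
Require Import Defs.
From HB Require Import structures.
From mathcomp Require Import all_boot all_order all_algebra.
From mathcomp Require Import all_classical all_reals all_analysis.
From mathcomp Require Import measurable_realfun ring lra.
Import Order.TTheory GRing.Theory Num.Theory.
Import numFieldNormedType.Exports.
Local Open Scope classical_set_scope.
Local Open Scope ring_scope.

(** * Minimizers of a penalized Gram quadratic *)

Section PenalizedGram.
Context {R : realType} {I E : finType}.
Variables (g : I -> E -> R) (nu : R) (off : pred I) (s : I -> R).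
Hypothesis nu_gt0 : 0 < nu.

(** In the application [nu] is 1/n and [e] runs over observations and score components, so this is
    the empirical J. *)
Definition gram (a b : I) : R := nu * \sum_e g a e * g b e.

Definition comb (w : I -> R) (e : E) : R := \sum_a w a * g a e.

Definition qobj (w : I -> R) : R :=
  2^-1 * (\sum_a \sum_b w a * gram a b * w b) - \sum_a w a * gram a a.

Definition pen (w : I -> R) : R := \sum_(a | off a) `|w a| / s a ^+ 2.

Definition pen_feasible (w : I -> R) : Prop :=
  forall a, off a -> s a = 0 -> w a = 0.

Definition pen_minimizer (mu : R) (w : I -> R) : Prop :=
  pen_feasible w /\
  forall w', pen_feasible w' -> qobj w + mu * pen w <= qobj w' + mu * pen w'.

Definition grad (w : I -> R) (a : I) : R :=
  (\sum_b gram a b * w b) - gram a a.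

Definition diag1 (a : I) : R := (~~ off a)%:R.

Hypothesis gram_diag : forall a b,
  ~~ off a -> ~~ off b -> a != b -> gram a b = 0.

Lemma quad_gramE w v :
  \sum_a \sum_b w a * gram a b * v b = nu * \sum_e comb w e * comb v e.
Proof.
under [in RHS]eq_bigr do rewrite /comb big_distrlr /=.
rewrite [in RHS]exchange_big /= mulr_sumr; apply: eq_bigr => a _.
rewrite exchange_big /= mulr_sumr; apply: eq_bigr => b _.
rewrite /gram !mulr_sumr mulr_suml; apply: eq_bigr => e _; ring.
Qed.

Lemma combD (t : R) w v e : comb (fun a => w a + t * v a) e = comb w e + t * comb v e.
Proof.
by rewrite /comb mulr_sumr -big_split /=; apply: eq_bigr => a _; ring.
Qed.

Lemma qobj_line w v (t : R) :
  qobj (fun a => w a + t * v a) =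
  qobj w + t * (\sum_a v a * grad w a) + 2^-1 * t ^+ 2 * (nu * \sum_e comb v e ^+ 2).
Proof.
rewrite /qobj !quad_gramE.
have -> : \sum_a v a * grad w a =
    nu * (\sum_e comb w e * comb v e) - \sum_a v a * gram a a.
  rewrite -[in RHS](eq_bigr _ (fun e _ => mulrC (comb v e) (comb w e))).
  rewrite -quad_gramE -sumrB; apply: eq_bigr => a _.
  rewrite /grad mulrBr mulr_sumr; congr (_ - _).
  by apply: eq_bigr => b _; rewrite mulrA.
have -> : \sum_a (w a + t * v a) * gram a a =
    \sum_a w a * gram a a + t * \sum_a v a * gram a a.
  by rewrite mulr_sumr -big_split /=; apply: eq_bigr => a _; ring.
have -> : \sum_e comb (fun a => w a + t * v a) e * comb (fun a => w a + t * v a) e =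
    \sum_e comb w e * comb w e + 2 * t * (\sum_e comb w e * comb v e)
    + t ^+ 2 * \sum_e comb v e ^+ 2.
  rewrite !mulr_sumr -!big_split /=; apply: eq_bigr => e _.
  by rewrite combD; ring.
by field.
Qed.

Lemma pen_ge0 w : 0 <= pen w.
Proof. by apply: sumr_ge0 => a _; rewrite divr_ge0 ?sqr_ge0. Qed.

Lemma pen_diag1 : pen diag1 = 0.
Proof. by apply: big1 => a oa; rewrite /diag1 oa normr0 mul0r. Qed.

Lemma pen_feasible_diag1 : pen_feasible diag1.
Proof. by move=> a oa _; rewrite /diag1 oa. Qed.

Lemma pen_feasible_line w v (t : R) : pen_feasible w -> pen_feasible v ->
  pen_feasible (fun a => w a + t * v a).
Proof. by move=> fw fv a oa sa; rewrite fw// fv// mulr0 addr0. Qed.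

(** Where [s a = 0] the quotient is 0 by convention, so the penalty is silent there and feasibility
    supplies the value. *)
Lemma pen_eq0 w a : pen_feasible w -> pen w = 0 -> off a -> w a = 0.
Proof.
move=> fw /eqP; rewrite psumr_eq0; last first.
  by move=> b _; rewrite divr_ge0 ?sqr_ge0.
move=> /allP /(_ a (mem_index_enum _)) /implyP pa oa.
have := pa oa; rewrite mulf_eq0 normr_eq0 invr_eq0 sqrf_eq0.
by move=> /orP[/eqP//|/eqP/fw]; apply.
Qed.

(** Feasible vectors form a linear space, so [t] takes both signs and the first-order term must
    vanish. *)
Lemma pen_minimizer0_grad w v : pen_minimizer 0 w -> pen_feasible v ->
  \sum_a v a * grad w a = 0.
Proof.
move=> [fw mw] fv.
set c := \sum_a _; set q := nu * \sum_e comb v e ^+ 2.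
have q0 : 0 <= q by apply: mulr_ge0; rewrite ?(ltW nu_gt0)// sumr_ge0// => e _; rewrite sqr_ge0.
have H (t : R) : 0 <= t * c + 2^-1 * t ^+ 2 * q.
  have := mw _ (pen_feasible_line w v t fw fv).
  by rewrite !mul0r !addr0 qobj_line -/c -/q -addrA lerDl.
(* The denominator [1 + q], in place of the optimal [q], avoids the case [q = 0]. *)
have := H (- (c / (1 + q))).
have q1 : 0 < 1 + q by lra.
have -> : - (c / (1 + q)) * c + 2^-1 * (- (c / (1 + q))) ^+ 2 * q =
  - (c ^+ 2 * ((1 + 2^-1 * q) / (1 + q) ^+ 2)) by field; lra.
rewrite oppr_ge0 pmulr_lle0; last by rewrite divr_gt0 ?exprn_gt0//; lra.
by move=> c2; apply/eqP; rewrite -sqrf_eq0 eq_le c2 sqr_ge0.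
Qed.

(** Halfway between two minimizers the penalty is at most the average, while the quadratic lies
    [q / 8] below its average; hence [q], the scaled squared norm of the fit of the difference, is
    zero. *)
Lemma pen_minimizer_comb mu w w' : 0 <= mu ->
  pen_minimizer mu w -> pen_minimizer mu w' ->
  forall e, comb (fun a => w' a - w a) e = 0.
Proof.
move=> mu0 [fw mw] [fw' mw'].
set v := fun a => w' a - w a.
have fv : pen_feasible v by move=> a oa sa; rewrite /v fw// fw'// subrr.
have E1 : w' = (fun a => w a + 1 * v a) by apply/funext => a; rewrite /v; ring.
have Q1 := qobj_line w v 1; rewrite -E1 in Q1.
have Q2 := qobj_line w v 2^-1.
have le1 := mw _ (pen_feasible_line w v 2^-1 fw fv).
have le2 := mw' _ fw.
have le3 := mw _ fw'.
have penh : pen (fun a => w a + 2^-1 * v a) <= 2^-1 * (pen w + pen w').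
  rewrite /pen -big_split mulr_sumr; apply: ler_sum => a _ /=.
  rewrite -mulrDl mulrA ler_wpM2r ?invr_ge0 ?sqr_ge0//.
  have -> : w a + 2^-1 * v a = 2^-1 * (w a + w' a) by rewrite /v; field.
  by rewrite normrM ger0_norm ?invr_ge0// ler_wpM2l ?invr_ge0 ?ler_normD.
have := ler_wpM2l mu0 penh.
set q := nu * _ in Q1 Q2 *.
move=> penh'.
have q0 : q <= 0 by lra.
have : \sum_e comb v e ^+ 2 = 0.
  apply/eqP; rewrite eq_le sumr_ge0 ?andbT; last by move=> *; rewrite sqr_ge0.
  by rewrite -(pmulr_rle0 _ nu_gt0).
move=> /eqP; rewrite psumr_eq0; last by move=> *; rewrite sqr_ge0.
move=> /allP H e; apply/eqP; rewrite -sqrf_eq0.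
exact: H (mem_index_enum _).
Qed.

(** Along a direction of zero fit the slope of [qobj] is the same at every base point, and at the
    minimizer [w0] it is zero. *)
Lemma qobj_null w0 w w' : pen_minimizer 0 w0 -> pen_feasible w -> pen_feasible w' ->
  (forall e, comb (fun a => w' a - w a) e = 0) -> qobj w' = qobj w.
Proof.
move=> m0 fw fw'; set v := fun a => _ => H.
have fv : pen_feasible v by move=> a oa sa; rewrite /v fw// fw'// subrr.
have C0 : \sum_e comb v e ^+ 2 = 0.
  by rewrite big1// => e _; rewrite H expr0n.
have lin u : \sum_a v a * grad u a = - \sum_a v a * gram a a.
  transitivity (\sum_a \sum_b v a * gram a b * u b - \sum_a v a * gram a a).
    rewrite -sumrB; apply: eq_bigr => a _.
    rewrite /grad mulrBr mulr_sumr; congr (_ - _).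
    by apply: eq_bigr => b _; rewrite mulrA.
  by rewrite quad_gramE big1 ?mulr0 ?sub0r// => e _; rewrite H mul0r.
have E1 : w' = (fun a => w a + 1 * v a) by apply/funext => a; rewrite /v; ring.
rewrite E1 qobj_line C0 lin -(lin w0) (pen_minimizer0_grad w0 v m0 fv).
by ring.
Qed.

(** Equal fits give equal [qobj], so minimality forces the penalty of [w] down to that of [diag1],
    which is zero. *)
Lemma pen_minimizer_diag1 mu w w0 : 0 < mu -> pen_minimizer 0 w0 ->
  pen_minimizer mu diag1 -> pen_minimizer mu w -> forall a, off a -> w a = 0.
Proof.
move=> mu0 m0 m1 m a oa; have [fw mw] := m.
have H := pen_minimizer_comb mu diag1 w (ltW mu0) m1 m.
have Q := qobj_null w0 diag1 w m0 pen_feasible_diag1 fw H.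
apply: pen_eq0 => //; apply/eqP; rewrite eq_le pen_ge0 andbT.
have := mw _ pen_feasible_diag1.
by rewrite Q lerD2l pen_diag1 mulr0 pmulr_rle0.
Qed.

Lemma grad_diag1_diag a : ~~ off a -> grad diag1 a = 0.
Proof.
move=> oa; rewrite /grad (bigD1 a)//= big1 ?addr0.
  by rewrite /diag1 oa mulr1 subrr.
move=> b ba; rewrite /diag1; case: (boolP (off b)) => ob /=.
  by rewrite mulr0.
by rewrite gram_diag ?mul0r// eq_sym.
Qed.

(** Tangent inequality of a convex quadratic; the diagonal part of the gradient vanishes at
    [diag1]. *)
Lemma qobj_diag1_le w : qobj diag1 + \sum_(a | off a) w a * grad diag1 a <= qobj w.
Proof.
set v := fun a => w a - diag1 a.
have E1 : w = (fun a => diag1 a + 1 * v a) by apply/funext => a; rewrite /v; ring.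
have Q := qobj_line diag1 v 1; rewrite -E1 in Q; rewrite Q mul1r.
have -> : \sum_a v a * grad diag1 a = \sum_(a | off a) w a * grad diag1 a.
  rewrite (bigID off) /= [X in _ + X]big1 ?addr0.
    by apply: eq_bigr => a oa; rewrite /v /diag1 oa subr0.
  by move=> a oa; rewrite grad_diag1_diag// mulr0.
rewrite lerDl expr1n mulr1 !mulr_ge0 ?invr_ge0 ?(ltW nu_gt0)//.
by apply: sumr_ge0 => *; rewrite sqr_ge0.
Qed.

(** At such a level each weighted absolute value absorbs its own linear term in the tangent
    inequality. *)
Lemma pen_minimizer_diag1_large mu :
  \sum_(a | off a) s a ^+ 2 * `|grad diag1 a| <= mu -> pen_minimizer mu diag1.
Proof.
move=> hmu; split; first exact: pen_feasible_diag1.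
move=> w fw; rewrite pen_diag1 mulr0 addr0.
apply: le_trans (lerD (qobj_diag1_le w) (lexx _)).
rewrite -addrA lerDl /pen mulr_sumr -big_split /=.
apply: sumr_ge0 => a oa.
have [sa|sa] := eqVneq (s a) 0; first by rewrite fw// !mul0r normr0 mul0r mulr0 addr0.
have ha : `|grad diag1 a| <= mu / s a ^+ 2.
  rewrite ler_pdivlMr ?exprn_even_gt0// mulrC (le_trans _ hmu)//.
  rewrite (bigD1 a)//= lerDl sumr_ge0// => b _.
  by rewrite mulr_ge0 ?sqr_ge0.
have : - (w a * grad diag1 a) <= mu * (`|w a| / s a ^+ 2).
  rewrite (le_trans (ler_norm _))// normrN normrM mulrCA ler_wpM2l//.
lra.
Qed.

Lemma diag1_minimizes_diag w : (forall a, off a -> w a = 0) -> qobj diag1 <= qobj w.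
Proof.
move=> w0; apply: le_trans (qobj_diag1_le w); rewrite lerDl big1//.
by move=> a oa; rewrite w0// mul0r.
Qed.

(* Two minimizers at the same penalty level have the same fit, and since the
   unpenalized problem is bounded below they also have the same penalty.  So a
   diagonal minimizer at a positive level forces every minimizer there to be
   diagonal, and an off-diagonal selection can only survive at level 0. *)
Lemma first_diagonal_level (kap : R) (what : R -> I -> R) :
  0 < kap ->
  (forall lam, 0 <= lam -> pen_minimizer (lam / kap) (what lam)) ->
  let lh := inf [set lam : R | 0 <= lam /\ forall a, off a -> what lam a = 0] in
  forall a, off a -> what lh a != 0 ->
  [/\ s a != 0, pen_minimizer 0 diag1
    & forall e, comb (fun b => what lh b - diag1 b) e = 0].
Proof.
move=> kap0 hwhat; set L := [set lam | _] => lh a oa nz.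
have m0 : pen_minimizer 0 (what 0) by have := hwhat 0 (lexx _); rewrite mul0r.
(* A large level belongs to [L], so [lh] is a genuine infimum and not a default value. *)
have Lne : L !=set0.
  pose mu := 1 + \sum_(a | off a) s a ^+ 2 * `|grad diag1 a|.
  have mu0 : 0 < mu.
    by rewrite ltr_wpDr// sumr_ge0// => b _; rewrite mulr_ge0 ?sqr_ge0.
  have kmu : 0 <= kap * mu by rewrite mulr_ge0 ?ltW.
  exists (kap * mu); split => // b ob.
  apply: (pen_minimizer_diag1 mu _ (what 0)) => //.
    by apply: pen_minimizer_diag1_large; rewrite lerDr.
  by have := hwhat _ kmu; rewrite [kap * mu / kap]mulrAC divff ?mul1r// gt_eqF.
have Llb : has_lbound L by exists 0 => x [].
have lh0 : 0 <= lh by apply: lb_le_inf => // x [].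
(* For a fixed competitor [w] the comparison is affine in the level, so it passes from [L] to its
   infimum even if [lh] is not in [L]. *)
have mlh : pen_minimizer (lh / kap) diag1.
  split; first exact: pen_feasible_diag1.
  move=> w fw; rewrite pen_diag1 mulr0 addr0.
  have HL lam : L lam -> qobj diag1 <= qobj w + lam / kap * pen w.
    move=> [l0 ld]; have [fl ml] := hwhat _ l0.
    apply: le_trans (ml _ fw).
    apply: (le_trans (diag1_minimizes_diag _ ld)).
    by rewrite lerDl mulr_ge0 ?pen_ge0// divr_ge0// ltW.
  have [p0|p0] := eqVneq (pen w) 0.
    by have [x /HL] := Lne; rewrite p0 !mulr0.
  have pw : 0 < pen w by rewrite lt_neqAle eq_sym p0 pen_ge0.
  rewrite addrC -lerBlDr -ler_pdivrMr// ler_pdivlMr//.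
  apply: lb_le_inf => // x /HL.
  by rewrite addrC -lerBlDr -ler_pdivrMr// ler_pdivlMr.
have mw := hwhat _ lh0.
have H := pen_minimizer_comb _ _ _ (divr_ge0 lh0 (ltW kap0)) mlh mw.
(* At a positive level the minimizer [diag1] would force [what lh] to be diagonal, against [nz]. *)
have lh_eq0 : lh = 0.
  apply/eqP; rewrite eq_le lh0 andbT leNgt; apply/negP => lhp.
  move/eqP: nz; apply.
  by apply: (pen_minimizer_diag1 (lh / kap) _ (what 0)) => //; rewrite divr_gt0.
split => //; last by move: mlh; rewrite lh_eq0 mul0r.
by apply/eqP => sa; move/eqP: nz; apply; have [fw _] := mw; exact: fw.
Qed.

End PenalizedGram.

(** * Scores of the univariate and bivariate likelihoods *)

Section Pairs.
Context {p : nat}.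
Implicit Types (a b : pairT p) (j k : 'I_p).

Lemma val_spair j k : val (spair j k) = if (j <= k)%N then (j, k) else (k, j).
Proof.
rewrite /spair val_insubd.
by case: (leqP j k) => [jk|/ltnW kj] /=; rewrite ?jk ?kj.
Qed.

Lemma pj_diag j : pj (spair j j) = j.
Proof. by rewrite /pj val_spair leqnn. Qed.

Lemma pk_diag j : pk (spair j j) = j.
Proof. by rewrite /pk val_spair leqnn. Qed.

Lemma pj_spair j k : (j <= k)%N -> pj (spair j k) = j.
Proof. by move=> jk; rewrite /pj val_spair jk. Qed.

Lemma pk_spair j k : (j <= k)%N -> pk (spair j k) = k.
Proof. by move=> jk; rewrite /pk val_spair jk. Qed.

Lemma spair_pjk a : spair (pj a) (pk a) = a.
Proof.
apply/val_inj; rewrite val_spair; case: a => [[j k]] /= jk.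
by rewrite /pj /pk /= jk.
Qed.

Lemma offdiagF a : ~~ offdiag a -> a = spair (pj a) (pj a).
Proof.
rewrite -{2}[a]spair_pjk /offdiag -leqNgt; case: a => [[j k]] /= jk kj.
apply/val_inj; rewrite !val_spair /pj /pk /= in kj *.
by have /val_inj -> : j = k :> nat by apply/eqP; rewrite eqn_leq jk.
Qed.

Lemma offdiag_diag j : offdiag (spair j j) = false.
Proof. by rewrite /offdiag pj_diag pk_diag ltnn. Qed.

Lemma diag_inj j k : spair j j = spair k k -> j = k.
Proof. by move=> /(congr1 (@pj p)); rewrite !pj_diag. Qed.

End Pairs.

Section Score.
Context {R : realType}.

Lemma ent_vech {p} (M : 'M[R]_p) j k : M^T = M -> ent (vech M) j k = M j k.
Proof.
move=> MT; rewrite /ent /vech /pj /pk val_spair; case: ifP => _ //=.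
by rewrite -[in LHS]MT mxE.
Qed.

Lemma uvec_eq0 {p} (a b : pairT p) (v : pairT p -> R) x :
  b != a -> b != spair (pj a) (pj a) -> b != spair (pk a) (pk a) ->
  uvec a v x b = 0.
Proof.
move=> ba bj bk; rewrite /uvec.
have E : (fun t : R => ell a (fun c => v c + (if c == b then t else 0)) x) =
    cst (ell a v x).
  apply/funext => t; rewrite /ell /ent spair_pjk.
  by rewrite ![_ == b]eq_sym (negbTE ba) (negbTE bj) (negbTE bk) !addr0.
by rewrite E derive1_cst.
Qed.

(** Univariate and bivariate log-likelihoods share this form, with [D] the variance or determinant
    and [N] the numerator of the quadratic form. *)
Lemma derive1_loglik (D N : R -> R) (D' N' : R) :
  0 < D 0 -> is_derive (0 : R) 1 D D' -> is_derive (0 : R) 1 N N' ->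
  derive1 (fun t => - ln (D t) - N t / D t) 0 =
  - (D' / D 0) - (N' * D 0 - N 0 * D') / D 0 ^+ 2.
Proof.
move=> D0 dD dN; rewrite derive1E.
have D0' : D 0 != 0 by rewrite gt_eqF.
have dl : is_derive (0 : R) 1 (fun t => ln (D t)) (D' / D 0).
  have := is_derive1_ln D0 => dln.
  have := @is_derive1_comp _ (@ln R) D 0 _ _ dln dD.
  by rewrite mulrC.
have dV : is_derive (0 : R) 1 (fun t => (D t)^-1) (- (D 0) ^- 2 *: D').
  exact: is_deriveV.
have dNV : is_derive (0 : R) 1 (fun t => N t * (D t)^-1)
    (N 0 *: (- (D 0) ^- 2 *: D') + (D 0)^-1 *: N').
  exact: is_deriveM.
have dA := is_deriveB (is_deriveN dl) dNV.
rewrite (@derive_val _ _ _ _ _ _ _ dA) /GRing.scale /=.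
by field.
Qed.

Lemma is_derive_quadratic (f : R -> R) (c0 c1 c2 : R) :
  (forall t, f t = c0 + c1 * t + c2 * t ^+ 2) -> is_derive (0 : R) 1 f c1.
Proof.
move=> fE.
have -> : f = cst c0 + (c1 \*: id) + (c2 \*: (id ^+ 2)).
  apply/funext => t; rewrite fE.
  by rewrite !fctE.
apply: is_derive_eq; rewrite /GRing.scale /=; ring.
Qed.

Lemma uvec_diag {p} (v : pairT p -> R) x j : 0 < v (spair j j) ->
  uvec (spair j j) v x (spair j j) =
  x j ^+ 2 / v (spair j j) ^+ 2 - (v (spair j j))^-1.
Proof.
move=> v0; rewrite /uvec.
pose D t : R := v (spair j j) + t.
pose N (t : R) : R := x j ^+ 2.
transitivity (derive1 (fun t => - ln (D t) - N t / D t) 0).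
  congr (derive1 _ 0); apply/funext => t.
  by rewrite /ell /ent pj_diag pk_diag !eqxx /D /N.
have dD : is_derive (0 : R) 1 D 1.
  by apply: (is_derive_quadratic _ (v (spair j j)) 1 0) => t; rewrite /D; ring.
have dN : is_derive (0 : R) 1 N 0 by rewrite /N; exact: is_derive_cst.
have D0 : D 0 = v (spair j j) by rewrite /D addr0.
rewrite (derive1_loglik D N 1 0) ?D0// /N; field.
by rewrite gt_eqF.
Qed.

Section OffDiagonalScore.
Context {p : nat} (v : pairT p -> R) (x : 'I_p -> R) (j k : 'I_p).
Hypothesis jk : (j < k)%N.
Let a := v (spair j j).
Let b := v (spair k k).
Let r := v (spair j k).
Let D := a * b - r ^+ 2.
Hypothesis D_gt0 : 0 < D.

Let jNk : (j == k) = false.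
Proof. by apply/negbTE; rewrite -val_eqE /= neq_ltn jk. Qed.

Let D_neq0 : a * b - r ^+ 2 != 0. Proof. by rewrite gt_eqF. Qed.

Lemma spair_diag_neq :
  (((spair j j == spair k k) = false) * ((spair k k == spair j j) = false)) *
  (((spair j k == spair j j) = false) * ((spair j k == spair k k) = false)) *
  (((spair j j == spair j k) = false) * ((spair k k == spair j k) = false)).
Proof.
have dj : spair j j != spair k k.
  by apply/eqP => /diag_inj /eqP; rewrite jNk.
have oj l : spair j k != spair l l.
  apply/eqP => /(congr1 (@offdiag p)).
  by rewrite offdiag_diag /offdiag pj_spair ?pk_spair ?(ltnW jk)// jk.
by do !split; apply/negbTE; rewrite ?oj ?dj// eq_sym ?oj ?dj.
Qed.

(** With z the image of (x_j, x_k) under the inverse of [[a, r], [r, b]], this is z_1^2 - b / D. *)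
Lemma uvec_off_jj : uvec (spair j k) v x (spair j j) =
  (b * x j - r * x k) ^+ 2 / D ^+ 2 - b / D.
Proof.
pose Dt t : R := (a + t) * b - r ^+ 2.
pose N t : R := b * x j ^+ 2 - 2 * r * x j * x k + (a + t) * x k ^+ 2.
rewrite /uvec; transitivity (derive1 (fun t => - ln (Dt t) - N t / Dt t) 0).
  congr (derive1 _ 0); apply/funext => t.
  rewrite /ell /ent pj_spair ?pk_spair ?(ltnW jk)// jNk !eqxx !spair_diag_neq !addr0.
  by rewrite /Dt /N /a /b /r.
have dD : is_derive (0 : R) 1 Dt b.
  apply: (is_derive_quadratic _ D _ 0) => t.
  by rewrite /Dt /D; ring.
have dN : is_derive (0 : R) 1 N (x k ^+ 2).
  apply: (is_derive_quadratic _ (N 0) _ 0) => t.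
  by rewrite /N; ring.
have D0 : Dt 0 = D by rewrite /Dt addr0.
rewrite (derive1_loglik Dt N _ _ _ dD dN) ?D0// /N /D; field.
exact: D_neq0.
Qed.

Lemma uvec_off_kk : uvec (spair j k) v x (spair k k) =
  (a * x k - r * x j) ^+ 2 / D ^+ 2 - a / D.
Proof.
pose Dt t : R := a * (b + t) - r ^+ 2.
pose N t : R := (b + t) * x j ^+ 2 - 2 * r * x j * x k + a * x k ^+ 2.
rewrite /uvec; transitivity (derive1 (fun t => - ln (Dt t) - N t / Dt t) 0).
  congr (derive1 _ 0); apply/funext => t.
  rewrite /ell /ent pj_spair ?pk_spair ?(ltnW jk)// jNk !eqxx !spair_diag_neq !addr0.
  by rewrite /Dt /N /a /b /r.
have dD : is_derive (0 : R) 1 Dt a.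
  apply: (is_derive_quadratic _ D _ 0) => t.
  by rewrite /Dt /D; ring.
have dN : is_derive (0 : R) 1 N (x j ^+ 2).
  apply: (is_derive_quadratic _ (N 0) _ 0) => t.
  by rewrite /N; ring.
have D0 : Dt 0 = D by rewrite /Dt addr0.
rewrite (derive1_loglik Dt N _ _ _ dD dN) ?D0// /N /D; field.
exact: D_neq0.
Qed.

(** In the same notation this is 2 (z_1 z_2 + r / D); the two symmetric entries move together,
    whence the factor 2. Its zero set is the conic. *)
Lemma uvec_off_jk : uvec (spair j k) v x (spair j k) =
  2 * ((b * x j - r * x k) * (a * x k - r * x j) / D ^+ 2 + r / D).
Proof.
pose Dt t : R := a * b - (r + t) ^+ 2.
pose N t : R := b * x j ^+ 2 - 2 * (r + t) * x j * x k + a * x k ^+ 2.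
rewrite /uvec; transitivity (derive1 (fun t => - ln (Dt t) - N t / Dt t) 0).
  congr (derive1 _ 0); apply/funext => t.
  rewrite /ell /ent pj_spair ?pk_spair ?(ltnW jk)// jNk !eqxx !spair_diag_neq !addr0.
  by rewrite /Dt /N /a /b /r.
have dD : is_derive (0 : R) 1 Dt (- 2 * r).
  apply: (is_derive_quadratic _ D _ (-1)) => t.
  by rewrite /Dt /D; ring.
have dN : is_derive (0 : R) 1 N (- 2 * x j * x k).
  apply: (is_derive_quadratic _ (N 0) _ 0) => t.
  by rewrite /N; ring.
have D0 : Dt 0 = D by rewrite /Dt addr0.
rewrite (derive1_loglik Dt N _ _ _ dD dN) ?D0// /N /D; field.
exact: D_neq0.
Qed.

End OffDiagonalScore.
End Score.

(** * Algebra of the scores on the conic z_1 z_2 = - r / D *)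

Section ConicIdentities.
Context {R : realType}.

(** Since x = a z_1 + r z_2, the two sides differ by 2 r / a times the equation of the conic. *)
Lemma conic_score_shift (a b r x y : R) : a != 0 -> a * b - r ^+ 2 != 0 ->
  (b * x - r * y) * (a * y - r * x) / (a * b - r ^+ 2) ^+ 2
    + r / (a * b - r ^+ 2) = 0 ->
  x ^+ 2 / a ^+ 2 - a^-1 - ((b * x - r * y) ^+ 2 / (a * b - r ^+ 2) ^+ 2
    - b / (a * b - r ^+ 2)) =
  r ^+ 2 / a ^+ 2 * ((a * y - r * x) ^+ 2 / (a * b - r ^+ 2) ^+ 2
    - a / (a * b - r ^+ 2)).
Proof.
move=> a0 D0 Q; apply/eqP; rewrite -subr_eq0; apply/eqP.
transitivity (2 * r / a * ((b * x - r * y) * (a * y - r * x) / (a * b - r ^+ 2) ^+ 2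
    + r / (a * b - r ^+ 2))); last by rewrite Q mulr0.
by field; rewrite a0 D0.
Qed.

(* With [z] the image of [(x, y)] under the inverse of [[a, r], [r, b]], the
   factors are [z1^2 - b / D] and [z2^2 - a / D].  On the conic [z1 z2 = - r / D]
   the product [z1^2 z2^2] is constant, so only linear terms in the second
   moments remain. *)
Lemma conic_score_prod (a b r x y : R) : a * b - r ^+ 2 != 0 ->
  (b * x - r * y) * (a * y - r * x) / (a * b - r ^+ 2) ^+ 2
    + r / (a * b - r ^+ 2) = 0 ->
  ((b * x - r * y) ^+ 2 / (a * b - r ^+ 2) ^+ 2 - b / (a * b - r ^+ 2)) *
  ((a * y - r * x) ^+ 2 / (a * b - r ^+ 2) ^+ 2 - a / (a * b - r ^+ 2)) =
  (r ^+ 2 + a * b) / (a * b - r ^+ 2) ^+ 2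
  - ((a * b + r ^+ 2) * (b * x ^+ 2 + a * y ^+ 2) - 4 * a * b * r * (x * y))
    / (a * b - r ^+ 2) ^+ 3.
Proof.
move=> D0 /eqP; rewrite addr_eq0 => /eqP Q.
set D := a * b - r ^+ 2 in D0 Q *.
transitivity (((b * x - r * y) * (a * y - r * x) / D ^+ 2) ^+ 2
  - (a * (b * x - r * y) ^+ 2 + b * (a * y - r * x) ^+ 2) / D ^+ 3 + a * b / D ^+ 2).
  by field.
rewrite Q; field.
exact: D0.
Qed.

(** On the conic this sum is n (J_{jk,jj} + J_{jk,kk} - J_{jk,jk}). The shift identity, used once
    for each coordinate, turns every term into a fixed positive multiple of [u i * v i]. *)
Lemma sum_conic_scores {n : nat} (x y u v : 'I_n -> R) (a b r D : R) : (0 < n)%N ->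
  a = n%:R^-1 * \sum_i x i * x i -> b = n%:R^-1 * \sum_i y i * y i ->
  r = n%:R^-1 * \sum_i x i * y i ->
  0 < a -> 0 < b -> r != 0 -> D = a * b - r ^+ 2 -> 0 < D ->
  (forall i, (b * x i - r * y i) * (a * y i - r * x i) / D ^+ 2 + r / D = 0) ->
  (forall i, u i = (b * x i - r * y i) ^+ 2 / D ^+ 2 - b / D) ->
  (forall i, v i = (a * y i - r * x i) ^+ 2 / D ^+ 2 - a / D) ->
  \sum_i (u i * (x i ^+ 2 / a ^+ 2 - a^-1 - u i)
        + v i * (y i ^+ 2 / b ^+ 2 - b^-1 - v i)) < 0.
Proof.
move=> n0 aE bE rE a0 b0 r0 DE D0 Q uE vE.
have Q' := Q; rewrite DE in D0 Q'.
have nR : n%:R != 0 :> R by rewrite pnatr_eq0 -lt0n.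
have an : a != 0 by rewrite gt_eqF.
have bn : b != 0 by rewrite gt_eqF.
have Dn : a * b - r ^+ 2 != 0 by rewrite gt_eqF.
have DC : b * a - r ^+ 2 = a * b - r ^+ 2 by rewrite (mulrC b).
have sx : \sum_i x i * x i = n%:R * a by rewrite aE mulVKf.
have sy : \sum_i y i * y i = n%:R * b by rewrite bE mulVKf.
have sxy : \sum_i x i * y i = n%:R * r by rewrite rE mulVKf.
have termE i : u i * (x i ^+ 2 / a ^+ 2 - a^-1 - u i)
        + v i * (y i ^+ 2 / b ^+ 2 - b^-1 - v i) =
    r ^+ 2 * (a ^- 2 + b ^- 2) * (u i * v i).
  rewrite uE vE DE (conic_score_shift a b r (x i) (y i))//.
  have := conic_score_shift b a r (y i) (x i); rewrite DC => ->//; first by ring.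
  by rewrite (mulrC (a * y i - r * x i)).
have uvE i : u i * v i = (r ^+ 2 + a * b) / D ^+ 2
    - (a * b + r ^+ 2) * b / D ^+ 3 * (x i * x i)
    - (a * b + r ^+ 2) * a / D ^+ 3 * (y i * y i)
    + 4 * a * b * r / D ^+ 3 * (x i * y i).
  by rewrite uE vE DE (conic_score_prod a b r (x i) (y i))//; field.
under eq_bigr do rewrite termE uvE.
rewrite -mulr_sumr big_split /= !sumrB sumr_const card_ord -mulr_natl -!mulr_sumr sx sy sxy.
(* [t] is the sum of the [u i * v i]; it collapses because [a], [b], [r] are exactly the sample
   second moments. *)
set t := (X in _ * X); have -> : t = - (n%:R / D) by rewrite /t DE; field.
rewrite mulrN oppr_lt0; apply: mulr_gt0; last by rewrite divr_gt0 ?ltr0n// DE.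
by apply: mulr_gt0; rewrite ?exprn_even_gt0// addr_gt0// invr_gt0 exprn_gt0.
Qed.

End ConicIdentities.

(** * The selected set at a nondegenerate sample *)

Section Selection.
Context {R : realType} {T : Type} {p n : nat}.
Variables (Xs : 'I_n -> 'I_p -> T -> R) (om : T).
Let S := Scov Xs om.
Let x i := fun l : 'I_p => Xs i l om.
Let g (a : pairT p) (e : 'I_n * pairT p) : R := uvec a (vech S) (x e.1) e.2.
Let s (a : pairT p) : R := S (pj a) (pk a).

Hypothesis n_gt0 : (0 < n)%N.

Lemma Scov_sym : S^T = S.
Proof.
by apply/matrixP => a b; rewrite !mxE; under eq_bigr do rewrite mulrC.
Qed.

Lemma Scov_diag_ge0 l : 0 <= S l l.
Proof.
rewrite mxE mulr_ge0 ?invr_ge0 ?ler0n//.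
by apply: sumr_ge0 => i _; rewrite -expr2 sqr_ge0.
Qed.

Lemma Jhat_gram a b : Jhat Xs om a b = gram g n%:R^-1 a b.
Proof. by rewrite /Jhat /gram /UtU pair_big. Qed.

Lemma objectiveE lam w : objective Xs om lam w =
  qobj g n%:R^-1 w + lam / n%:R * pen (@offdiag p) s w.
Proof.
rewrite /objective /qobj /pen; congr (_ * _ - _ + _).
  by apply: eq_bigr => a _; apply: eq_bigr => b _; rewrite Jhat_gram.
by apply: eq_bigr => a _; rewrite Jhat_gram.
Qed.

Lemma is_minimizerE lam w : is_minimizer Xs om lam w ->
  pen_minimizer g n%:R^-1 (@offdiag p) s (lam / n%:R) w.
Proof.
move=> [fw mw]; split => // w' fw'.
by rewrite -!objectiveE; exact: mw.
Qed.

(** The score of a diagonal pair has only its own component, so distinct ones have disjoint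
    supports. *)
Lemma gram_diag0 a b : ~~ offdiag a -> ~~ offdiag b -> a != b ->
  gram g n%:R^-1 a b = 0.
Proof.
move=> oa ob ab; rewrite /gram big1 ?mulr0// => -[i c] _; rewrite /g /=.
have ea := offdiagF a oa; have eb := offdiagF b ob.
have [ca|ca] := eqVneq c a.
  rewrite [X in _ * X](_ : _ = 0) ?mulr0//.
  apply: uvec_eq0; rewrite ca// {1}ea; apply/eqP => /diag_inj pab.
    by move/eqP: ab; apply; rewrite ea eb pab.
  move/eqP: ab; apply; rewrite ea eb pab.
  by rewrite [in LHS]eb pk_diag.
rewrite [X in X * _](_ : _ = 0) ?mul0r//.
apply: uvec_eq0 => //; rewrite -?ea//.
by rewrite [in X in spair X _]ea [in X in spair _ X]ea !pk_diag -ea.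
Qed.

Lemma tstat_le a : tstat Xs om a <= n%:R.
Proof.
rewrite /tstat -/S; set q := S _ _ ^+ 2; set c := S (pj a) (pj a) * _.
have c0 : 0 <= c by rewrite mulr_ge0 ?Scov_diag_ge0.
have q0 : 0 <= q by rewrite sqr_ge0.
(* A vanishing denominator gives the quotient 0. *)
have [->|qc] := eqVneq (q + c) 0; first by rewrite invr0 mulr0 ler0n.
rewrite ler_pdivrMr; last by rewrite lt_neqAle eq_sym qc addr_ge0.
by rewrite ler_wpM2l// lerDl.
Qed.

Lemma sum_scores_off a (f : pairT p -> 'I_n -> R) :
  offdiag a ->
  (forall c i, c != a -> c != spair (pj a) (pj a) -> c != spair (pk a) (pk a) ->
    f c i = 0) ->
  \sum_(e : 'I_n * pairT p) f e.2 e.1 =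
  \sum_i (f (spair (pj a) (pj a)) i + f (spair (pk a) (pk a)) i + f a i).
Proof.
move=> oa f0.
rewrite -(pair_bigA _ (fun i c => f c i)) /=; apply: eq_bigr => i _.
have jk : (pj a < pk a)%N by [].
have [[[e1 e2] [e3 e4]] [e5 e6]] := spair_diag_neq (pj a) (pk a) jk.
rewrite spair_pjk in e3 e4 e5 e6.
rewrite (bigD1 (spair (pj a) (pj a)))//= (bigD1 (spair (pk a) (pk a))) ?e2//=.
rewrite (bigD1 a) ?e3 ?e4//= big1 ?addr0 ?addrA// => c.
by move=> /andP[/andP[cj ck] ca]; exact: f0.
Qed.

Variables (what : T -> R -> pairT p -> R) (gam : R) (j k : 'I_p).
Hypothesis le_n_gam : n%:R <= gam.
Hypothesis what_min : forall lam, 0 <= lam -> is_minimizer Xs om lam (what om lam).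
Hypothesis jk : (j < k)%N.
Hypothesis S_pos : 0 < S j j * S k k - S j k ^+ 2.

Lemma nondegenerate_not_selected : ~ Ehat Xs what gam om (spair j k).
Proof.
rewrite /Ehat /= => sel.
have vS l l' : vech S (spair l l') = S l l' by rewrite -(ent_vech S _ _ Scov_sym).
have [pj_jk pk_jk] : pj (spair j k) = j /\ pk (spair j k) = k.
  by rewrite pj_spair ?pk_spair ?(ltnW jk).
have ojk : offdiag (spair j k) by rewrite /offdiag pj_jk pk_jk.
have Sjj : 0 < S j j.
  rewrite lt_neqAle Scov_diag_ge0 andbT eq_sym; apply/eqP => S0.
  by have := sqr_ge0 (S j k); move: S_pos; rewrite S0 mul0r; lra.
have Skk : 0 < S k k.
  rewrite lt_neqAle Scov_diag_ge0 andbT eq_sym; apply/eqP => S0.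
  by have := sqr_ge0 (S j k); move: S_pos; rewrite S0 mulr0; lra.
(* As [tstat] is at most n and n is at most [gam], no nonzero off-diagonal entry passes the test:
   the admissible levels are those with a diagonal minimizer. *)
have lamhatE : lamhat Xs what gam om =
    inf [set lam : R | 0 <= lam /\ forall a, offdiag a -> what om lam a = 0].
  rewrite /lamhat; congr inf; apply/seteqP; split => lam /= [l0 H]; split => // a oa.
    apply/eqP/negPn/negP => /(H a oa).
    by rewrite ltNge (le_trans (tstat_le a)).
  by rewrite (H a oa) eqxx.
rewrite lamhatE in sel.
have nV : 0 < n%:R^-1 :> R by rewrite invr_gt0 ltr0n.
have nP : 0 < n%:R :> R by rewrite ltr0n.
have [] := first_diagonal_level g n%:R^-1 (@offdiag p) s nV gram_diag0 n%:R
  (what om) nP (fun lam l0 => is_minimizerE lam _ (what_min lam l0)) _ ojk sel.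
set w := what om _; rewrite /s pj_jk pk_jk => r0 m0 cw.
pose u a i b := uvec a (vech S) (x i) b.
(* At component jk of the fit equation only the score of jk contributes, with the nonzero
   coefficient [w (spair j k)]. *)
have u_jk i : u (spair j k) i (spair j k) = 0.
  have := cw (i, spair j k); rewrite /comb (bigD1 (spair j k))//= big1 ?addr0.
    rewrite /diag1 ojk subr0 => /eqP; rewrite mulf_eq0.
    by rewrite (negbTE sel) /= => /eqP.
  move=> a aj; rewrite /g /= uvec_eq0 ?mulr0//; first by rewrite eq_sym.
    by apply/eqP => /(congr1 (@offdiag p)); rewrite ojk offdiag_diag.
  by apply/eqP => /(congr1 (@offdiag p)); rewrite ojk offdiag_diag.
(* The coordinate direction jk, feasible because [S j k] is nonzero; stationarity along it gives the
   equation for the empirical J. *)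
pose v (a : pairT p) : R := (a == spair j k)%:R.
have fv : pen_feasible (@offdiag p) s v.
  move=> a oa sa; rewrite /v; case: eqP => // aE.
  by move: sa; rewrite /s aE pj_jk pk_jk => /eqP; rewrite (negbTE r0).
have := pen_minimizer0_grad g n%:R^-1 (@offdiag p) s nV _ v m0 fv.
rewrite (bigD1 (spair j k))//= big1 ?addr0; last first.
  by move=> a aj; rewrite /v (negbTE aj) mul0r.
rewrite /v eqxx mul1r /grad (bigD1 (spair j j))//= (bigD1 (spair k k)) /=; last first.
  by apply/eqP => /diag_inj kj; move: jk; rewrite kj ltnn.
rewrite big1 ?addr0; last first.
  move=> b /andP[bj bk]; rewrite /diag1; case: (boolP (offdiag b)) => ob /=.
    by rewrite mulr0.
  have eb := offdiagF b ob.
  rewrite mulr1 /gram big1 ?mulr0// => -[i c] _; rewrite /g /=.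
  have [cb|cb] := eqVneq c b.
    rewrite [X in X * _](_ : _ = 0) ?mul0r//.
    apply: uvec_eq0; rewrite ?pj_jk ?pk_jk cb//.
    by apply/eqP => bE; move: ob; rewrite bE ojk.
  rewrite [X in _ * X](_ : _ = 0) ?mulr0//.
  apply: uvec_eq0 => //; rewrite -?eb//.
  by rewrite [in X in spair X _]eb [in X in spair _ X]eb !pk_diag -eb.
have d1 l : diag1 (@offdiag p) (spair l l) = 1 :> R by rewrite /diag1 offdiag_diag.
rewrite !d1 [X in X + _ - _]mulr1 [X in _ + X - _]mulr1.
have sumE b : (forall c i, c != spair j k -> c != spair j j -> c != spair k k ->
    u (spair j k) i c * u b i c = 0).
  by move=> c i c1 c2 c3; rewrite /u [X in X * _]uvec_eq0 ?mul0r// ?pj_jk ?pk_jk.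
have gE b : gram g n%:R^-1 (spair j k) b = n%:R^-1 *
    \sum_i (u (spair j k) i (spair j j) * u b i (spair j j)
      + u (spair j k) i (spair k k) * u b i (spair k k)).
  rewrite /gram; congr (_ * _).
  rewrite (sum_scores_off (spair j k) (fun c i => u (spair j k) i c * u b i c) ojk).
    by rewrite pj_jk pk_jk; apply: eq_bigr => i _; rewrite u_jk mul0r addr0.
  by move=> c i c1; rewrite pj_jk pk_jk => c2 c3; exact: sumE.
have lin3 (A B C : R) : n%:R^-1 * A + n%:R^-1 * B - n%:R^-1 * C = 0 -> A + B - C = 0.
  move=> H; apply: (mulfI (lt0r_neq0 nV)).
  by rewrite mulr0 -H mulrBr mulrDr.
rewrite (gE (spair j j)).
rewrite (gE (spair k k)).
rewrite (gE (spair j k)).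
move=> /lin3.
rewrite -big_split -sumrB /= => E0.
have [[[e1 e2] [e3 e4]] [e5 e6]] := spair_diag_neq j k jk.
have u0 i : u (spair k k) i (spair j j) = 0 by rewrite /u uvec_eq0 ?pj_diag ?pk_diag ?e1.
have u1 i : u (spair j j) i (spair k k) = 0 by rewrite /u uvec_eq0 ?pj_diag ?pk_diag ?e2.
have ujj i : u (spair j j) i (spair j j) = x i j ^+ 2 / S j j ^+ 2 - (S j j)^-1.
  by rewrite /u uvec_diag ?vS.
have ukk i : u (spair k k) i (spair k k) = x i k ^+ 2 / S k k ^+ 2 - (S k k)^-1.
  by rewrite /u uvec_diag ?vS.
have vpos : 0 < vech S (spair j j) * vech S (spair k k) - vech S (spair j k) ^+ 2.
  by rewrite !vS.
have conic i : (S k k * x i j - S j k * x i k) * (S j j * x i k - S j k * x i j)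
    / (S j j * S k k - S j k ^+ 2) ^+ 2 + S j k / (S j j * S k k - S j k ^+ 2) = 0.
  have := u_jk i; rewrite /u uvec_off_jk// !vS => /eqP.
  by rewrite mulf_eq0 pnatr_eq0 /= => /eqP.
have Sx l l' : S l l' = n%:R^-1 * \sum_i x i l * x i l' by rewrite mxE.
(* The sum that stationarity sets to zero in [E0] is strictly negative on the conic. *)
have := sum_conic_scores (fun i => x i j) (fun i => x i k) _ _ (S j j) (S k k)
  (S j k) _ n_gt0 (Sx j j) (Sx k k) (Sx j k) Sjj Skk r0 (erefl _) S_pos conic
  (fun=> erefl _) (fun=> erefl _).
rewrite [X in X < _](_ : _ = 0) ?ltxx// -[RHS]E0; apply: eq_bigr => i _.
rewrite u0 u1 ujj ukk /u uvec_off_jj// uvec_off_kk// !vS; ring.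
Qed.

End Selection.

(** * Moments and concentration of the sample covariance *)

Section RectangleLaws.
Local Open Scope ereal_scope.

Definition mfun_of {d d'} {T : measurableType d} {T' : measurableType d'}
    (f : T -> T') (mf : measurable_fun setT f) : {mfun T >-> T'} :=
  HB.pack f (isMeasurableFun.Build _ _ _ _ _ mf).

(** Rectangles are stable under intersection, generate the product sigma-algebra and include the
    whole space. *)
Lemma measure_eq_rectangles {R : realType} {d1 d2} {T1 : measurableType d1}
    {T2 : measurableType d2} (m1 m2 : {measure set (T1 * T2) -> \bar R}) :
  m1 setT < +oo ->
  (forall A B, measurable A -> measurable B -> m1 (A `*` B) = m2 (A `*` B)) ->
  forall C, measurable C -> m1 C = m2 C.
Proof.
move=> m1oo m12 C mC.
apply: (measure_unique
  [set A `*` B | A in @measurable _ T1 & B in @measurable _ T2] (fun=> setT)) => //.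
- exact: measurable_prod_measurableType.
- move=> ? ? [A1 mA1 [B1 mB1 <-]] [A2 mA2 [B2 mB2 <-]].
  exists (A1 `&` A2); first exact: measurableI.
  by exists (B1 `&` B2); [exact: measurableI|rewrite setXI].
- by move=> k; exists setT => //; exists setT => //; rewrite setXTT.
- by apply/seteqP; split => // x _; exists 0%N.
- by move=> ? [A mA [B mB <-]]; exact: m12.
Qed.

Context {R : realType} {d} {T : measurableType d} (P : probability T R).

(** Both sides are finite measures in [C]: the image under [V] of [P] restricted to [E], and the law
    of [V] scaled by [P E]. *)
Lemma indep_rectangles {d1 d2} {T1 : measurableType d1} {T2 : measurableType d2}
    (V : {mfun T >-> (T1 * T2)%type}) (E : set T) : measurable E ->
  (forall A B, measurable A -> measurable B ->
    P (V @^-1` (A `*` B) `&` E) = P (V @^-1` (A `*` B)) * P E) ->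
  forall C, measurable C -> P (V @^-1` C `&` E) = P (V @^-1` C) * P E.
Proof.
move=> mE H C mC.
have PE0 : (0 <= fine (P E))%R by rewrite fine_ge0.
pose c : {nonneg R} := NngNum PE0.
have cE : (c%:num)%:E = P E by rewrite /= fineK// fin_num_measure.
have mV : measurable_fun setT V by [].
pose m1_ : {measure set (T1 * T2) -> \bar R} := pushforward (mrestr P mE) V.
pose m1 := m1_ mV.
pose m2 : {measure set (T1 * T2) -> \bar R} := mscale c (distribution P V).
have m2E A : m2 A = P (V @^-1` A) * P E by rewrite /m2 /= /mscale cE muleC.
rewrite -m2E -[LHS]/(m1 C); apply: (measure_eq_rectangles m1 m2) => //.
  rewrite /m1 /m1_ /= /pushforward /mrestr preimage_setT setTI.
  by rewrite (le_lt_trans (probability_le1 P mE)) ?ltry.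
by move=> A B mA mB; rewrite m2E; exact: H.
Qed.

(** Independence identifies the joint law with the product law, and Fubini splits the integral. *)
Lemma expectation_mul_indep (U V : {mfun T >-> R}) :
  P.-integrable setT (fun w => (U w)%:E) ->
  P.-integrable setT (fun w => (V w)%:E) ->
  P.-integrable setT (fun w => (U w * V w)%:E) ->
  (forall A B, measurable A -> measurable B ->
    P (U @^-1` A `&` V @^-1` B) = P (U @^-1` A) * P (V @^-1` B)) ->
  \int[P]_w (U w * V w)%:E = (\int[P]_w (U w)%:E) * (\int[P]_w (V w)%:E).
Proof.
move=> iU iV iUV H.
have mW : measurable_fun setT (fun w => (U w, V w)) by exact: measurable_fun_pair.
pose W := mfun_of _ mW.
pose f (z : R * R) : \bar R := (z.1 * z.2)%:E.
have mf : measurable_fun setT f.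
  by apply/measurable_EFinP; apply: measurable_funM; [exact: measurable_fst|exact: measurable_snd].
have lawE C : measurable C -> (distribution P U \x distribution P V) C = distribution P W C.
  by move=> mC; apply: product_measure_unique => // A B mA mB; rewrite -H.
have ifW : (distribution P W).-integrable setT f by exact: integrable_pushforward.
have ifp : (distribution P U \x distribution P V).-integrable setT f.
  apply/integrableP; split => //; move/integrableP : ifW => [_].
  rewrite (@eq_measure_integral _ _ _ _ (distribution P U \x distribution P V))//.
  by move=> A mA _; exact/esym/lawE.
transitivity (\int[distribution P W]_z f z).
  by rewrite integral_pushforward.
rewrite (@eq_measure_integral _ _ _ _ (distribution P U \x distribution P V)); last first.
  by move=> A mA _; exact/esym/lawE.
rewrite -integral12_prod_meas1// /fubini_F /f /=.
have EFm : measurable_fun setT (EFin : R -> \bar R).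
  exact/measurable_EFinP.
have EV : \int[distribution P V]_y y%:E = \int[P]_w (V w)%:E.
  by rewrite integral_pushforward.
have EU : \int[distribution P U]_y y%:E = \int[P]_w (U w)%:E.
  by rewrite integral_pushforward.
have iV' : (distribution P V).-integrable setT (EFin : R -> \bar R).
  exact: integrable_pushforward.
have iU' : (distribution P U).-integrable setT (EFin : R -> \bar R).
  exact: integrable_pushforward.
under eq_integral.
  move=> x _; under eq_integral do rewrite EFinM.
  rewrite integralZl// EV; over.
have EVfin : \int[P]_w (V w)%:E \is a fin_num by exact: integrable_fin_num.
rewrite -(fineK EVfin) integralZr//.
by rewrite EU.
Qed.

(** Chebyshev's inequality: orthogonality leaves n diagonal terms, so the mean square is at most
    [M / n]. *)
Lemma mean_deviation_le {n : nat} (Y : 'I_n -> T -> R) (M del : R) :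
  (0 < n)%N -> (0 < del)%R ->
  (forall i, measurable_fun setT (Y i)) ->
  (forall i i', P.-integrable setT (fun w => (Y i w * Y i' w)%:E)) ->
  (forall i, \int[P]_w (Y i w * Y i w)%:E <= M%:E) ->
  (forall i i', i != i' -> \int[P]_w (Y i w * Y i' w)%:E = 0) ->
  P [set w | (del <= `|n%:R^-1 * \sum_i Y i w|)%R] <= (M / (n%:R * del ^+ 2))%:E.
Proof.
move=> n0 del0 mY iY YM Y0.
have nR : (0 < n%:R :> R)%R by rewrite ltr0n.
pose Z w := (n%:R^-1 * \sum_i Y i w)%R.
have mZ : measurable_fun setT Z.
  by apply: measurable_funM => //; exact: measurable_sum.
have EZ : \int[P]_w (Z w ^+ 2)%:E <= (M / n%:R)%:E.
  apply: (@le_trans _ _ (\int[P]_w \sum_(e : 'I_n * 'I_n) (n%:R ^- 2 * (Y e.1 w * Y e.2 w))%:E)).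
    rewrite (eq_integral (fun w => \sum_(e : 'I_n * 'I_n) (n%:R ^- 2 * (Y e.1 w * Y e.2 w))%:E))// => w _; rewrite sumEFin; congr (_%:E).
    rewrite -mulr_sumr -(pair_bigA _ (fun i i' => Y i w * Y i' w)%R) /=.
    by rewrite -big_distrlr /= /Z exprMn exprVn expr2.
  rewrite integral_sum//; last first.
    by move=> e; under eq_fun do rewrite EFinM; exact: integrableZl.
  rewrite -(pair_bigA _ (fun i i' => \int[P]_w (n%:R ^- 2 * (Y i w * Y i' w))%:E)) /=.
  apply: (@le_trans _ _ (\sum_(i < n) (n%:R ^- 2 * M)%:E)).
    apply: lee_sum => i _; rewrite (bigD1 i)//= big1 ?adde0.
      under eq_integral do rewrite EFinM.
      rewrite integralZl// EFinM lee_pmul2l ?lte_fin ?invr_gt0 ?exprn_gt0//.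
    move=> i' ii'; under eq_integral do rewrite EFinM.
    by rewrite integralZl// Y0 ?mule0// eq_sym.
  rewrite sumEFin lee_fin sumr_const card_ord -[leLHS]mulr_natl.
  rewrite le_eqVlt; apply/orP; left; apply/eqP; field.
  by rewrite gt_eqF.
have := @markov _ _ _ P (mfun_of Z mZ) (fun x => x ^+ 2)%R del del0.
have mx : measurable_fun [set: R] (fun x : R => x ^+ 2)%R by [].
move=> /(_ mx (fun x _ => sqr_ge0 x)).
have hm : {in Num.nneg &, {homo (fun x : R => x ^+ 2)%R : x y / (x <= y)%R}}.
  by move=> x y; rewrite !nnegrE => x0 y0 xy; rewrite ler_sqr.
move=> /(_ hm); rewrite unlock /=.
under eq_integral do rewrite real_normK ?num_real//.
move=> /le_trans /(_ EZ) H.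
have -> : (M / (n%:R * del ^+ 2) = (M / n%:R) / del ^+ 2)%R.
  by field; rewrite !gt_eqF.
rewrite EFinM lee_pdivlMr ?exprn_gt0// muleC.
by apply: le_trans H.
Qed.

End RectangleLaws.

Lemma norm_mul_le_sqr {R : realDomainType} (x y : R) :
  `|x * y| <= x ^+ 2 + y ^+ 2.
Proof.
have := sqr_ge0 (x + y); have := sqr_ge0 (x - y).
have := sqr_ge0 x; have := sqr_ge0 y.
rewrite sqrrB sqrrD => ? ? ? ?; rewrite ler_norml.
by apply/andP; split; lra.
Qed.

(** * Domination, transfer between equal laws, and fourth moments *)

Section Moments.
Local Open Scope ereal_scope.
Context {R : realType} {d} {T : measurableType d} (P : probability T R).

Lemma integral_le_affine (f g : T -> R) (a b : R) : measurable_fun setT f ->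
  (forall w, 0 <= f w)%R -> (forall w, f w <= a * g w + b)%R ->
  P.-integrable setT (fun w => (g w)%:E) ->
  P.-integrable setT (fun w => (f w)%:E) /\
  \int[P]_w (f w)%:E <= a%:E * \int[P]_w (g w)%:E + b%:E.
Proof.
move=> mf f0 fg ig.
have iag : P.-integrable setT (fun w => a%:E * (g w)%:E) by exact: integrableZl.
have ib : P.-integrable setT (fun _ : T => b%:E).
  exact: (finite_measure_integrable_cst P b measurableT).
have iab : P.-integrable setT (fun w => a%:E * (g w)%:E + b%:E).
  exact: integrableD.
have ifi : P.-integrable setT (fun w => (f w)%:E).
  apply: le_integrable iab => //; first exact/measurable_EFinP.
  move=> w _; rewrite -EFinM -EFinD !abse_EFin lee_fin ger0_norm//.
  exact: le_trans (fg w) (ler_norm _).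
split => //.
have -> : a%:E * \int[P]_w (g w)%:E + b%:E = \int[P]_w (a%:E * (g w)%:E + b%:E).
  rewrite integralD// integralZl// integral_cst//= probability_setT mule1//.
by apply: le_integral => // w _; rewrite -EFinM -EFinD lee_fin.
Qed.

Lemma integral_eq_law {d'} {T' : measurableType d'} (V W : {mfun T >-> T'})
    (g : T' -> R) :
  (forall C, measurable C -> P (V @^-1` C) = P (W @^-1` C)) ->
  measurable_fun setT g ->
  P.-integrable setT (fun w => (g (W w))%:E) ->
  P.-integrable setT (fun w => (g (V w))%:E) /\
  \int[P]_w (g (V w))%:E = \int[P]_w (g (W w))%:E.
Proof.
move=> VW mg iW.
have mEg : measurable_fun setT (fun z => (g z)%:E) by exact/measurable_EFinP.
have law (h : T' -> \bar R) :
    \int[distribution P V]_z h z = \int[distribution P W]_z h z.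
  by apply: eq_measure_integral => A mA _; exact: VW.
have iV : P.-integrable setT (fun w => (g (V w))%:E).
  apply/integrableP; split; first exact: (measurableT_comp mEg).
  move/integrableP : iW => [_]; apply: le_lt_trans.
  have mag : measurable_fun setT (fun z => `|(g z)%:E|) by exact: measurableT_comp.
  rewrite -(ge0_integral_distribution V mag)//.
  by rewrite law (ge0_integral_distribution W mag).
split => //.
rewrite -[LHS](integral_distribution mEg)// law.
by rewrite (integral_distribution mEg).
Qed.

(** With t = theta_ll, the diagonal entry of J at ll is the mean of (X_l^2 / t^2 - 1 / t)^2, so
    bounds on J and Theta control the fourth moment independently of the dimension. *)
Lemma fourth_moment_le {p} (X : 'I_p -> T -> R) (Theta : 'M[R]_p) (l : 'I_p)
    (B C : R) :
  Theta^T = Theta -> (0 < Theta l l)%R -> (Theta l l <= B)%R ->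
  measurable_fun setT (X l) ->
  P.-integrable setT (fun w => (X l w ^+ 4)%:E) ->
  (Jmat P Theta X (spair l l) (spair l l) <= C)%R ->
  \int[P]_w (X l w ^+ 4)%:E <= (2 * B ^+ 4 * `|C| + 2 * B ^+ 2)%:E.
Proof.
move=> ThT t0 tB mX iX4 JC.
set t := Theta l l in t0 tB.
pose q w := ((X l w ^+ 2 / t ^+ 2 - t^-1) ^+ 2)%R.
have tn : t != 0%R by rewrite gt_eqF.
have UE w : UtU (vech Theta) (fun j => X j w) (spair l l) (spair l l) = q w.
  have vt : vech Theta (spair l l) = t by exact: (ent_vech Theta l l ThT).
  rewrite /UtU (bigD1 (spair l l))//= big1 ?addr0.
    by rewrite uvec_diag ?vt// -expr2.
  by move=> c cl; rewrite uvec_eq0 ?mul0r// ?pj_diag ?pk_diag.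
have mq : measurable_fun setT q.
  apply: measurable_funX; apply: measurable_funB => //.
  by apply: measurable_funM => //; exact: measurable_funX.
have q0 w : (0 <= q w)%R by exact: sqr_ge0.
(* Serves integrability of [q]: [Jmat] applies [fine], which would hide an infinite expectation. *)
have qX w : (q w <= 2 / t ^+ 4 * X l w ^+ 4 + 2 / t ^+ 2)%R.
  rewrite /q -subr_ge0.
  have -> : (2 / t ^+ 4 * X l w ^+ 4 + 2 / t ^+ 2 - (X l w ^+ 2 / t ^+ 2 - t^-1) ^+ 2
    = (X l w ^+ 2 / t ^+ 2 + t^-1) ^+ 2)%R by field.
  exact: sqr_ge0.
have [iq _] := integral_le_affine q _ _ _ mq q0 qX iX4.
have Xq w : (X l w ^+ 4 <= 2 * t ^+ 4 * q w + 2 * t ^+ 2)%R.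
  rewrite /q -subr_ge0.
  have -> : (2 * t ^+ 4 * (X l w ^+ 2 / t ^+ 2 - t^-1) ^+ 2 + 2 * t ^+ 2 - X l w ^+ 4
    = (X l w ^+ 2 - 2 * t) ^+ 2)%R by field.
  exact: sqr_ge0.
have X40 w : (0 <= X l w ^+ 4)%R by rewrite exprn_even_ge0.
have [_] := integral_le_affine _ q _ _ (measurable_funX 4 mX) X40 Xq iq.
move=> /le_trans; apply.
have qfin : \int[P]_w (q w)%:E \is a fin_num by exact: integrable_fin_num.
rewrite -(fineK qfin) -EFinM -EFinD lee_fin.
have qC : (fine (\int[P]_w (q w)%:E) <= `|C|)%R.
  apply: le_trans (ler_norm C); apply: le_trans JC.
  rewrite /Jmat unlock le_eqVlt; apply/orP; left; apply/eqP; congr fine.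
  by apply: eq_integral => w _; rewrite UE.
have Q0 : (0 <= fine (\int[P]_w (q w)%:E))%R.
  by apply: fine_ge0; apply: integral_ge0 => w _; rewrite lee_fin.
have t4 : (t ^+ 4 <= B ^+ 4)%R by rewrite lerXn2r// nnegrE ltW// (lt_le_trans t0).
have t2 : (t ^+ 2 <= B ^+ 2)%R by rewrite lerXn2r// nnegrE ltW// (lt_le_trans t0).
rewrite lerD// ?ler_pM2l//.
by rewrite ler_pM// ?ler_pM2l// mulr_ge0// exprn_ge0// ltW.
Qed.

End Moments.

(** * Concentration of one entry of the sample covariance *)

Section SampleCovariance.
Local Open Scope ereal_scope.
Context {R : realType} {d} {T : measurableType d} (P : probability T R).
Context {p n : nat} (X : 'I_p -> T -> R) (Xs : 'I_n -> 'I_p -> T -> R).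
Hypothesis mX : forall l, measurable_fun setT (X l).
Hypothesis mXs : forall i l, measurable_fun setT (Xs i l).
Hypothesis same_law : forall (i : 'I_n) (B : 'I_p -> set R),
  (forall l, measurable (B l)) ->
  P [set w | forall l, B l (Xs i l w)] = P [set w | forall l, B l (X l w)].
Hypothesis indep : forall (B : 'I_n -> 'I_p -> set R),
  (forall i l, measurable (B i l)) ->
  P [set w | forall i l, B i l (Xs i l w)] =
  \prod_(i < n) P [set w | forall l, B i l (Xs i l w)].

Variables (l l' : 'I_p) (M : R) (del : R).
Hypothesis iX4 : P.-integrable setT (fun w => (X l w ^+ 4)%:E).
Hypothesis iX4' : P.-integrable setT (fun w => (X l' w ^+ 4)%:E).
Hypothesis X4M : \int[P]_w (X l w ^+ 4)%:E <= M%:E.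
Hypothesis X4M' : \int[P]_w (X l' w ^+ 4)%:E <= M%:E.
Hypothesis n_gt0 : (0 < n)%N.
Hypothesis del_gt0 : (0 < del)%R.

(** The hypotheses on laws speak of boxes in all [p] coordinates; this box constrains only [l] and
    [l'], and the intersection covers [l = l']. *)
Let rect (A1 A2 : set R) (q : 'I_p) : set R :=
  (if q == l then A1 else setT) `&` (if q == l' then A2 else setT).

Let rectE (f : 'I_p -> T -> R) A1 A2 :
  [set w | forall q, rect A1 A2 q (f q w)] =
  (fun w => (f l w, f l' w)) @^-1` (A1 `*` A2).
Proof.
apply/seteqP; split => w /= H.
  by split; [have [] := H l|have [] := H l']; rewrite eqxx.
by move=> q; split; case: eqP => // ->; have [] := H.
Qed.

Let measurable_rect A1 A2 q : measurable A1 -> measurable A2 ->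
  measurable (rect A1 A2 q).
Proof. by move=> mA1 mA2; apply: measurableI; case: ifP. Qed.

Let mV i : measurable_fun setT (fun w => (Xs i l w, Xs i l' w)).
Proof. exact: measurable_fun_pair. Qed.
Let V i := mfun_of _ (mV i).

Let mV0 : measurable_fun setT (fun w => (X l w, X l' w)).
Proof. exact: measurable_fun_pair. Qed.
Let V0 := mfun_of _ mV0.

Let law_pair i C : measurable C -> P (V i @^-1` C) = P (V0 @^-1` C).
Proof.
move=> mC; rewrite -[LHS]/(distribution P (V i) C) -[RHS]/(distribution P V0 C).
apply: measure_eq_rectangles mC => [|A B mA mB].
  by rewrite /= /distribution /pushforward preimage_setT probability_setT ltry.
have := same_law i (rect A B) (fun q => measurable_rect A B q mA mB).
by rewrite (rectE (Xs i)) (rectE X).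
Qed.

(** Leaving the other observations unconstrained gives the case of two rectangles; the two events
    are then made arbitrary one after the other. *)
Let indep_pair i i' C C' : i != i' -> measurable C -> measurable C' ->
  P (V i @^-1` C `&` V i' @^-1` C') = P (V i @^-1` C) * P (V i' @^-1` C').
Proof.
move=> ii'.
have mpre k (D : set (R * R)) : measurable D -> measurable (V k @^-1` D).
  by move=> mD; rewrite -[X in measurable X]setTI; exact: mV.
have H A1 A2 B1 B2 : measurable A1 -> measurable A2 -> measurable B1 ->
    measurable B2 -> P (V i @^-1` (A1 `*` A2) `&` V i' @^-1` (B1 `*` B2)) =
    P (V i @^-1` (A1 `*` A2)) * P (V i' @^-1` (B1 `*` B2)).
  move=> mA1 mA2 mB1 mB2.
  pose B k q := if k == i then rect A1 A2 q else if k == i' then rect B1 B2 q else setT.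
  have mB k q : measurable (B k q).
    by rewrite /B; case: ifP => _; [|case: ifP => _ //]; exact: measurable_rect.
  have i'i : (i' == i) = false by apply/negbTE; rewrite eq_sym.
  have Bi w : (forall q, B i q (Xs i q w)) = (V i @^-1` (A1 `*` A2)) w.
    by rewrite -[RHS]/(_ w) -(rectE (Xs i)) /B eqxx.
  have Bi' w : (forall q, B i' q (Xs i' q w)) = (V i' @^-1` (B1 `*` B2)) w.
    by rewrite -[RHS]/(_ w) -(rectE (Xs i')) /B i'i eqxx.
  have := indep B mB; rewrite (bigD1 i)//= (bigD1 i')/= 1?eq_sym//.
  rewrite [X in _ * (_ * X)]big1 ?mule1; last first.
    move=> k /andP[ki ki']; rewrite /B (negbTE ki) (negbTE ki').
    by rewrite (_ : [set _ | _] = setT) ?probability_setT//; apply/seteqP; split.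
  have -> : [set w | forall q, B i q (Xs i q w)] = V i @^-1` (A1 `*` A2).
    by apply/funext => w; exact: Bi.
  have -> : [set w | forall q, B i' q (Xs i' q w)] = V i' @^-1` (B1 `*` B2).
    by apply/funext => w; exact: Bi'.
  move=> <-; congr (P _); apply/seteqP; split => w.
    move=> [H1 H2] k q.
    have [->|ki] := eqVneq k i; first by move: q; rewrite Bi.
    have [->|ki'] := eqVneq k i'; first by move: q; rewrite Bi'.
    by rewrite /B (negbTE ki) (negbTE ki').
  move=> K; split; first by have := K i; rewrite Bi.
  by have := K i'; rewrite Bi'.
have H1 C0 B1 B2 : measurable C0 -> measurable B1 -> measurable B2 ->
    P (V i @^-1` C0 `&` V i' @^-1` (B1 `*` B2)) =
    P (V i @^-1` C0) * P (V i' @^-1` (B1 `*` B2)).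
  move=> mC0 mB1 mB2; apply: indep_rectangles => //.
    by apply: mpre; exact: measurableX.
  by move=> A1 A2 mA1 mA2; exact: H.
move=> mC mC'; rewrite setIC muleC; apply: indep_rectangles => //; first exact: mpre.
by move=> B1 B2 mB1 mB2; rewrite setIC muleC; exact: H1.
Qed.

(** Chebyshev's inequality for the centred products, whose second moment is bounded through (x y -
    th)^2 <= x^4 + y^4 + 2 th^2. *)
Lemma Scov_deviation_le (th : R) :
  \int[P]_w (X l w * X l' w)%:E = th%:E ->
  P [set w | (del <= `|Scov Xs w l l' - th|)%R] <=
  ((2 * M + 2 * th ^+ 2) / (n%:R * del ^+ 2))%:E.
Proof.
move=> Eth.
pose f (z : R * R) : R := (z.1 * z.2 - th)%R.
have mf : measurable_fun setT f.
  apply: measurable_funB => //; apply: measurable_funM.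
    exact: measurable_fst.
  exact: measurable_snd.
have mf2 : measurable_fun setT (fun z => f z ^+ 2)%R by exact: measurable_funX.
pose g w := (X l w ^+ 4 + X l' w ^+ 4)%R.
have ig : P.-integrable setT (fun w => (g w)%:E).
  exact: (integrableD measurableT iX4 iX4').
have Eg : \int[P]_w (g w)%:E <= (2 * M)%:E.
  rewrite integralD_EFin//= (_ : 2 * M = M + M)%R; last by ring.
  by rewrite EFinD; exact: leeD.
have mfV0 : measurable_fun setT (fun w => f (V0 w)) by exact: measurableT_comp.
have f2g w : (f (V0 w) ^+ 2 <= 1 * g w + 2 * th ^+ 2)%R.
  rewrite /f /g /=; set x := X l w; set y := X l' w.
  rewrite -subr_ge0.
  have -> : (1 * (x ^+ 4 + y ^+ 4) + 2 * th ^+ 2 - (x * y - th) ^+ 2 =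
    (x ^+ 2 - y ^+ 2) ^+ 2 + (x * y + th) ^+ 2)%R by ring.
  by rewrite addr_ge0 ?sqr_ge0.
have [if2 Ef2] := integral_le_affine P _ g _ _ (measurable_funX 2 mfV0)
  (fun w => sqr_ge0 _) f2g ig.
have [ixy _] : P.-integrable setT (fun w => (`|X l w * X l' w|)%:E) /\
    \int[P]_w (`|X l w * X l' w|)%:E <= 1%:E * \int[P]_w (g w)%:E + 1%:E.
  apply: integral_le_affine => //.
    by apply: measurableT_comp => //; exact: measurable_funM.
  move=> w; rewrite mul1r /g; set x := X l w; set y := X l' w.
  have := sqr_ge0 (x ^+ 2 - y ^+ 2); have := sqr_ge0 (`|x * y| - 1)%R.
  have : (`|x * y| ^+ 2 = x ^+ 2 * y ^+ 2)%R by rewrite real_normK ?num_real// exprMn.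
  have := sqr_ge0 (x * y).
  rewrite exprMn !sqrrB -!exprM; set u := `|_|%R; nra.
have ixy' : P.-integrable setT (fun w => (X l w * X l' w)%:E).
  apply: le_integrable ixy => //; first exact/measurable_EFinP/measurable_funM.
  by move=> w _; rewrite /= normr_id.
have if1 : P.-integrable setT (fun w => (f (V0 w))%:E).
  apply: (@integrableB _ _ _ P setT measurableT (fun w => (X l w * X l' w)%:E)
    (fun _ => th%:E)) => //.
  exact: (finite_measure_integrable_cst P th measurableT).
have Ef1 : \int[P]_w (f (V0 w))%:E = 0.
  rewrite [LHS](@integralB_EFin _ _ _ P setT (fun w => X l w * X l' w)%R
    (fun _ => th) measurableT)//; last exact: (finite_measure_integrable_cst P th measurableT).
  by rewrite Eth integral_cst//= probability_setT mule1 subee.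
have [T1 T2] : (forall i, P.-integrable setT (fun w => (f (V i w))%:E) /\
    \int[P]_w (f (V i w))%:E = 0) /\
    (forall i, P.-integrable setT (fun w => (f (V i w) ^+ 2)%:E) /\
    \int[P]_w (f (V i w) ^+ 2)%:E <= (2 * M + 2 * th ^+ 2)%:E).
  split=> i.
    have [? ->] := integral_eq_law P (V i) V0 f (law_pair i) mf if1.
    by rewrite Ef1.
  have [? ->] := integral_eq_law P (V i) V0 _ (law_pair i) mf2 if2.
  split => //; apply: (le_trans Ef2).
  by rewrite mul1e EFinD leeD2r.
pose Y i w := f (V i w).
have mY i : measurable_fun setT (Y i) by exact: measurableT_comp.
have iYY i i' : P.-integrable setT (fun w => (Y i w * Y i' w)%:E).
  have iS : P.-integrable setT (fun w => (Y i w ^+ 2 + Y i' w ^+ 2)%:E).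
    exact: (integrableD measurableT (T2 i).1 (T2 i').1).
  apply: le_integrable iS => //; first exact/measurable_EFinP/measurable_funM.
  move=> w _; rewrite !abse_EFin lee_fin [leRHS]ger0_norm ?addr_ge0 ?sqr_ge0//.
  exact: norm_mul_le_sqr.
have := mean_deviation_le P Y (2 * M + 2 * th ^+ 2) del n_gt0 del_gt0 mY iYY.
have EW : (fun w => n%:R^-1 * \sum_i Y i w)%R = (fun w => Scov Xs w l l' - th)%R.
  apply/funext => w; rewrite mxE /Y /f /= sumrB sumr_const card_ord mulrBr.
  by rewrite -[X in (_ - _ * X)%R]mulr_natl mulKf// pnatr_eq0 -lt0n.
have -> : [set w | (del <= `|n%:R^-1 * \sum_i Y i w|)%R] =
    [set w | (del <= `|Scov Xs w l l' - th|)%R].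
  by apply/funext => w /=; rewrite (congr1 (fun h => h w) EW).
apply.
  by move=> i; under eq_integral do rewrite -expr2; exact: (T2 i).2.
move=> i i' ii'.
(* Distinct observations are independent, so their centred products are uncorrelated. *)
have := expectation_mul_indep P (mfun_of _ (mY i)) (mfun_of _ (mY i'))
  (T1 i).1 (T1 i').1 (iYY i i').
move=> -> ; first by rewrite (T1 i).2 mul0e.
move=> A B mA mB.
have mpre (D : set R) : measurable D -> measurable (f @^-1` D).
  by move=> mD; rewrite -[X in measurable X]setTI; exact: mf.
exact: (indep_pair i i' (f @^-1` A) (f @^-1` B) ii' (mpre A mA) (mpre B mB)).
Qed.

Lemma measurable_Scov_deviation (th : R) :
  measurable [set w | (del <= `|Scov Xs w l l' - th|)%R].
Proof.
have mS : measurable_fun setT (fun w => `|Scov Xs w l l' - th|)%R.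
  apply: measurableT_comp => //; apply: measurable_funB => //.
  rewrite (_ : (fun w => _) = (fun w => n%:R^-1 * \sum_i Xs i l w * Xs i l' w)%R).
    apply: measurable_funM => //; apply: measurable_sum => i.
    exact: measurable_funM.
  by apply/funext => w; rewrite mxE.
have := mS measurableT `[del, +oo[%classic (measurable_itv _).
by rewrite setTI; congr measurable; apply/funext => w /=; rewrite in_itv /= andbT.
Qed.

End SampleCovariance.

(** * Vanishing probability of selecting a non-edge *)

Theorem theorem3
  (R : realType)
  (* the n-th model: dimension p n, covariance Theta n *)
  (p : nat -> nat) (Theta : forall n, 'M[R]_(p n))
  (* the n-th probability space, the generic vector X and the sample of size n *)
  (d : nat -> measure_display) (T : forall n, measurableType (d n))
  (P : forall n, probability (T n) R)
  (X : forall n, 'I_(p n) -> T n -> R)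
  (Xs : forall n, 'I_n -> 'I_(p n) -> T n -> R)
  (* threshold gamma_n and a choice of the minimizers hat w(lambda) *)
  (gam : nat -> R)
  (what : forall n, T n -> R -> pairT (p n) -> R)
  (* the pair jk (allowed to depend on n since p may) *)
  (j k : forall n, 'I_(p n)) :
  (* ---- distributional setting ---- *)
  (forall n, posdef (Theta n)) ->
  (forall n (l : 'I_(p n)), measurable_fun setT (X n l)) ->
  (forall n (i : 'I_n) (l : 'I_(p n)), measurable_fun setT (Xs n i l)) ->
  (forall n (l : 'I_(p n)), (P n).-integrable setT (fun w => ((X n l w) ^+ 4)%:E)) ->
  (forall n (l : 'I_(p n)), ('E_(P n)[X n l] = 0)%E) ->
  (forall n (l l' : 'I_(p n)),
      ('E_(P n)[fun w => (X n l w * X n l' w)%R] = (Theta n l l')%:E)%E) ->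
  (* X^(1), ..., X^(n) have the law of X *)
  (forall n (i : 'I_n) (B : 'I_(p n) -> set R), (forall l, measurable (B l)) ->
      P n [set w | forall l, B l (Xs n i l w)] = P n [set w | forall l, B l (X n l w)]) ->
  (* X^(1), ..., X^(n) are independent *)
  (forall n (B : 'I_n -> 'I_(p n) -> set R), (forall i l, measurable (B i l)) ->
      P n [set w | forall i l, B i l (Xs n i l w)] =
      (\prod_(i < n) P n [set w | forall l, B i l (Xs n i l w)])%E) ->
  (* ---- Condition C1 ---- *)
  (exists C : R, forall n (l l' : 'I_(p n)), `|Theta n l l'| <= C) ->
  (exists c0 : R, 0 < c0 /\
     forall n (l l' : 'I_(p n)), Theta n l l' != 0 -> c0 <= `|Theta n l l'|) ->
  (* ---- Condition C2 ---- *)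
  (exists C : R,
     forall n,
       let J := Jmat (P n) (Theta n) (X n) in
       let Jx := subM J (xi (Theta n)) in
       let hx := subV (fun a => J a a) (xi (Theta n)) in
       (forall a b, `|J a b| <= C) /\
       Jx \in unitmx /\
       (forall a b, `|invmx Jx a b| <= C) /\
       (forall a, `|(invmx Jx *m hx) a ord0| <= C)) ->
  (* ---- Condition C3 ---- *)
  (exists c : R, 0 < c /\
     forall n, (1 <= #|offsupp (Theta n)|)%N ->
       let J := Jmat (P n) (Theta n) (X n) in
       let Jx := subM J (xi (Theta n)) in
       let hx := subV (fun a => J a a) (xi (Theta n)) in
       forall (l : 'I_#|xi (Theta n)|) (x : 'cV[R]_(#|xi (Theta n)|.-1)),
         c < \sum_(r < #|xi (Theta n)|) `|(col' l Jx *m x - hx) r ord0|) ->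
  (* ---- threshold: gamma^{-1} = o(n^{-1}) ---- *)
  (forall n, 0 < gam n) ->
  (fun n : nat => (gam n)^-1%R) =o_\oo (fun n : nat => (n%:R : R)^-1%R) ->
  (* ---- hat w(lambda) minimizes the penalized objective ---- *)
  (forall n (om : T n) (lam : R), 0 <= lam -> is_minimizer (Xs n) om lam (what n om lam)) ->
  (* ---- the pair jk is a non-edge: j < k and theta_jk = 0 ---- *)
  (forall n, (j n < k n)%N) ->
  (forall n, Theta n (j n) (k n) = 0) ->
  (* ---- conclusion: Pr(jk \in hat E) -> 0 (as outer probability) ---- *)
  forall eps : R, 0 < eps -> exists N : nat, forall n : nat, (N <= n)%N ->
    exists A : set (T n), measurable A /\
      [set om | Ehat (Xs n) (what n) (gam n) om (spair (j n) (k n))] `<=` A /\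
      (P n A <= eps%:E)%E.
Proof.
move=> pdT mX mXs iX4 _ EXX law ind [B hB] [c0 [c0_gt0 hc0]] [C hC] _ gam_gt0 gamo
  what_min jk nonedge eps eps0.
pose M := 2 * B ^+ 4 * `|C| + 2 * B ^+ 2.
(* Variances are at least [c0]: deviations below [c0 / 2] leave both sample variances above [c0 / 2]
   and the sample covariance below it in absolute value. *)
pose del := c0 / 2.
have del0 : 0 < del by rewrite divr_gt0.
(* From sample size [K] on, each of the three Chebyshev bounds is at most [eps / 3]. *)
pose K := (2 * M + 2 * B ^+ 2) / (del ^+ 2 * (eps / 3)).
have M0 : 0 <= M.
  have B4 : 0 <= B ^+ 4 by rewrite exprn_even_ge0.
  apply: addr_ge0; last by apply: mulr_ge0 => //; exact: sqr_ge0.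
  by apply: mulr_ge0 => //; exact: mulr_ge0.
have K0 : 0 <= K.
  apply: divr_ge0; first by apply: addr_ge0; apply: mulr_ge0 => //; exact: sqr_ge0.
  by apply: mulr_ge0; [exact: sqr_ge0|rewrite divr_ge0// ltW].
(* The little-o with constant 1 gives [n <= gam n] eventually. *)
have /eqoP/(_ 1 ltr01) [N1 _ hN1] := gamo.
exists (maxn (maxn 1 N1) (Num.bound K)) => n.
rewrite !geq_max => /andP[/andP[n_gt0 N1n] Kn].
have n0 : 0 < n%:R :> R by rewrite ltr0n.
have n_le_gam : n%:R <= gam n.
  have := hN1 n N1n; rewrite mul1r !ger0_norm ?invr_ge0 ?ler0n ?(ltW (gam_gt0 n))//.
  by rewrite lef_pV2 ?posrE.
have Kn' : K <= n%:R.
  by apply: le_trans (ltW (archi_boundP K0)) _; rewrite ler_nat.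
have ThT := (pdT n).1.
have Thpos l : 0 < Theta n l l.
  have := (pdT n).2 (delta_mx l ord0).
  rewrite trmx_delta -rowE -colE !mxE; apply.
  by apply/eqP => /matrixP /(_ l ord0) /eqP; rewrite !mxE !eqxx oner_eq0.
have ThB l : Theta n l l <= B by apply: le_trans (ler_norm _) (hB n l l).
have Thc l : c0 <= Theta n l l.
  by have := hc0 n l l (lt0r_neq0 (Thpos l)); rewrite gtr0_norm.
have X4 l : (\int[P n]_w (X n l w ^+ 4)%:E <= M%:E)%E.
  apply: (fourth_moment_le (P n) (X n) (Theta n)) => //.
  exact: le_trans (ler_norm _) ((hC n).1 _ _).
have EX l l' : (\int[P n]_w (X n l w * X n l' w)%:E = (Theta n l l')%:E)%E.
  by rewrite -EXX unlock.
pose dev l l' := [set w | del <= `|Scov (Xs n) w l l' - Theta n l l'|].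
have mdev l l' : measurable (dev l l').
  exact: (measurable_Scov_deviation (Xs n) (mXs n) l l' del (Theta n l l')).
have Pdev l l' : (P n (dev l l') <= (eps / 3)%:E)%E.
  have := Scov_deviation_le (P n) (X n) (Xs n) (mX n) (mXs n) (law n) (ind n)
    l l' M del (iX4 n l) (iX4 n l') (X4 l) (X4 l') n_gt0 del0 _ (EX l l').
  move=> /le_trans; apply; rewrite lee_fin ler_pdivrMr ?mulr_gt0 ?exprn_gt0//.
  have th2 : Theta n l l' ^+ 2 <= B ^+ 2.
    by rewrite -real_normK ?num_real// lerXn2r// ?nnegrE// (le_trans _ (hB n l l')).
  apply: (@le_trans _ _ (2 * M + 2 * B ^+ 2)); first by rewrite lerD2l ler_pM2l.
  have := Kn'; rewrite /K ler_pdivrMr; last by rewrite mulr_gt0 ?exprn_gt0 ?divr_gt0.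
  by move=> /le_trans; apply; rewrite le_eqVlt; apply/orP; left; apply/eqP; ring.
set jn := j n in (jk) *; set kn := k n in (jk) *.
(* Off this event the 2 x 2 block of S at j, k has positive determinant, so the pair is not
   selected. *)
exists (dev jn jn `|` dev kn kn `|` dev jn kn); split; [|split].
- by apply: measurableU => //; exact: measurableU.
- move=> om sel; apply/not_notP => /not_orP [/not_orP [/negP + /negP +] /negP].
  rewrite -!ltNge => djj dkk djk; move: sel.
  apply: nondegenerate_not_selected => //; first exact: (what_min n om).
  move: djk; rewrite nonedge subr0 => djk.
  have c0E : c0 = 2 * del by rewrite /del; field.
  have Sjj : del < Scov (Xs n) om jn jn.
    by move: djj; rewrite ltr_norml => /andP[+ _]; have := Thc jn; rewrite c0E; lra.
  have Skk : del < Scov (Xs n) om kn kn.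
    by move: dkk; rewrite ltr_norml => /andP[+ _]; have := Thc kn; rewrite c0E; lra.
  rewrite subr_gt0 -real_normK ?num_real// expr2.
  apply: lt_trans (ltr_pM _ _ djk djk) (ltr_pM _ _ Sjj Skk); rewrite ?normr_ge0 ?ltW//.
- have mU : measurable (dev jn jn `|` dev kn kn) by exact: measurableU.
  apply: (le_trans (measureU2 (P n) mU (mdev jn kn))).
  have -> : eps%:E = ((eps / 3)%:E + (eps / 3)%:E + (eps / 3)%:E)%E.
    by rewrite -!EFinD; congr (_%:E); field.
  apply: leeD (Pdev _ _).
  apply: (le_trans (measureU2 (P n) (mdev jn jn) (mdev kn kn))).
  exact: (leeD (Pdev jn jn) (Pdev kn kn)).
Qed.
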